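(* Let $\mathbb{K}=\mathbb{R}$ or $\mathbb{K}=\mathbb{C}$, let $n\ge 2$ and $p\ge 2n-1$, and let $f,g:(\mathbb{K}^n,0)\to(\mathbb{K}^p,0)$ be two finite analytic map germs. If $f$ and $g$ are bi-Lipschitz equivalent (i.e. bi-Lipschitz $\mathcal{A}$-equivalent), then (1) $D(f)$ and $D(g)$ are bi-Lipschitz equivalent; (2) $\widetilde{D}(f)$ and $\widetilde{D}(g)$ are bi-Lipschitz equivalent; (3) $f(D(f))$ and $g(D(g))$ are bi-Lipschitz equivalent.
   Context: Two map germs $f,g:(\mathbb{K}^n,0)\to(\mathbb{K}^p,0)$ are bi-Lipschitz ($\mathcal{A}$-)equivalent if there are germs of bi-Lipschitz homeomorphisms $h:(\mathbb{K}^n,0)\to(\mathbb{K}^n,0)$ and $k:(\mathbb{K}^p,0)\to(\mathbb{K}^p,0)$ with $g=k\circ f\circ h^{-1}$. For a representative of $f$ on a sufficiently small neighbourhood $U$ of $0$, the double point set is $D(f)=\{x\in U:\exists\, x'\neq x \text{ in } U,\ f(x)=f(x')\}\cup\Sigma(f)$, where $\Sigma(f)$ is the singular set of $f$ (points where the differential of $f$ is not of maximal rank). Its lifting $\widetilde{D}(f)\subset U\times U$ is the set of pairs $(x,x')$ such that either $x\neq x'$ and $f(x)=f(x')$, or $x=x'\in\Sigma(f)$. All these sets are considered as germs at the origin. Two subsets (or germs at $0$ of subsets) $X,Y$ of $\mathbb{K}^N$ are here called bi-Lipschitz equivalent if there is a bi-Lipschitz homeomorphism (respectively a germ at $0$ of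 one) $\varphi$ of the ambient space $\mathbb{K}^N$ with $\varphi(X)=Y$. The ambient space is $\mathbb{K}^n$ in (1), $\mathbb{K}^n\times\mathbb{K}^n$ in (2), and $\mathbb{K}^p$ in (3). *)

(* Defs.v *)
From mathcomp Require Import all_boot all_order all_algebra.
From mathcomp Require Import finmap complex.
From mathcomp Require Import all_classical all_reals all_analysis.

Set Implicit Arguments.
Unset Strict Implicit.
Unset Printing Implicit Defensive.

Import Order.TTheory GRing.Theory Num.Theory.
Import numFieldNormedType.Exports.

Local Open Scope classical_set_scope.
Local Open Scope ring_scope.

Variant ground := RealGround | ComplexGround.

Definition ground_field (R : realType) (c : ground) : numFieldType :=
  match c with
  | RealGround => R
  | ComplexGround => R[i]
  end.

(* A map germ at 0 is represented by a total function; every notion below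
   depends only on its values on a neighbourhood of 0, or on the set U supplied
   for the double point sets. *)

Section Analytic.
Variables (K : numFieldType) (n : nat).

Definition monomial (a : {ffun 'I_n -> nat}) (x : 'rV[K]_n) : K :=
  \prod_(i < n) x 0 i ^+ a i.

(* Convergence is along the directed set of finite sets of multi-indices, so
   it does not depend on an ordering of the multi-indices. *)
Definition power_series_cvg (c : {ffun 'I_n -> nat} -> K) (x : 'rV[K]_n)
    (s : K) : Prop :=
  forall e : K, 0 < e ->
    exists A : {fset {ffun 'I_n -> nat}}, forall B : {fset {ffun 'I_n -> nat}},
      (A `<=` B)%fset -> `|s - \sum_(a <- B) c a * monomial a x| < e.

Definition analytic_fun_germ (u : 'rV[K]_n -> K) : Prop :=
  exists c : {ffun 'I_n -> nat} -> K,
    \forall x \near (0 : 'rV[K]_n), power_series_cvg c x (u x).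

End Analytic.

Section MapGerms.
Variables (K : numFieldType) (n p : nat).
Implicit Type f : 'rV[K]_n -> 'rV[K]_p.

Definition analytic_map_germ f : Prop :=
  f 0 = 0 /\ forall j : 'I_p, analytic_fun_germ (fun x => f x 0 j).

(* The ring of analytic germs on (K^n, 0) is a finitely generated module,
   through f, over the ring of analytic germs on (K^p, 0). *)
Definition finite_map_germ f : Prop :=
  exists (m : nat) (a : 'I_m -> 'rV[K]_n -> K),
    (forall i, analytic_fun_germ (a i)) /\
    forall u : 'rV[K]_n -> K, analytic_fun_germ u ->
      exists b : 'I_m -> 'rV[K]_p -> K,
        (forall i, analytic_fun_germ (b i)) /\
        \forall x \near (0 : 'rV[K]_n), u x = \sum_(i < m) b i (f x) * a i x.

Definition singular_set f : set 'rV[K]_n :=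
  [set x | (\rank (jacobian f x) < minn n p)%N].

Definition double_points f (U : set 'rV[K]_n) : set 'rV[K]_n :=
  [set x | U x /\
     ((exists x', [/\ U x', x' <> x & f x = f x']) \/ singular_set f x)].

Definition lifted_double_points f (U : set 'rV[K]_n) :
    set ('rV[K]_n * 'rV[K]_n) :=
  [set z | [/\ U z.1, U z.2 &
     (z.1 <> z.2 /\ f z.1 = f z.2) \/ (z.1 = z.2 /\ singular_set f z.1)]].

End MapGerms.

Section BiLipschitz.
Variables (K : numFieldType) (E : normedModType K).

Definition bilipschitz_homeo (U V : set E) (h hi : E -> E) : Prop :=
  [/\ (forall x, U x -> V (h x) /\ hi (h x) = x),
      (forall y, V y -> U (hi y) /\ h (hi y) = y),
      [lipschitz h x | x in U] & [lipschitz hi y | y in V]].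

(* The germs at 0 of h and hi are inverse to each other and bi-Lipschitz; U and
   V are the neighbourhoods on which the chosen representatives are so. *)
Definition bilipschitz_germ_on (U V : set E) (h hi : E -> E) : Prop :=
  [/\ open_nbhs 0 U, open_nbhs 0 V, h 0 = 0 & bilipschitz_homeo U V h hi].

Definition bilipschitz_germ (h hi : E -> E) : Prop :=
  exists U V : set E, bilipschitz_germ_on U V h hi.

Definition bilipschitz_equiv_set_germs (X Y : set E) : Prop :=
  exists (U V : set E) (phi phii : E -> E),
    bilipschitz_germ_on U V phi phii /\ phi @` (X `&` U) = Y `&` V.

End BiLipschitz.

Definition bilipschitz_A_equiv (K : numFieldType) (n p : nat)
    (f g : 'rV[K]_n -> 'rV[K]_p) : Prop :=
  exists (h hi : 'rV[K]_n -> 'rV[K]_n) (k ki : 'rV[K]_p -> 'rV[K]_p),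
    [/\ bilipschitz_germ h hi, bilipschitz_germ k ki &
        \forall x \near (0 : 'rV[K]_n), g x = k (f (hi x))].

(* Main.v *)
Require Import Defs.
From mathcomp Require Import all_boot all_order all_algebra.
From mathcomp Require Import finmap complex ring.
From mathcomp Require Import all_classical all_reals all_analysis.

(** Since [g \o h = k \o f] near 0, the homeomorphism [h] carries pairs of
    points with the same image under [f] to pairs with the same image under
    [g]. The point is that it also carries the singular set of [f] to that of
    [g], although it need not be differentiable. This holds because, for
    [n <= p], the singular set has a metric description
    ([singular_iff_not_expansive]): an analytic map is strictly differentiable
    near 0, and at such a point its differential is injective if and only if
    [`|y - z| <= C * `|f y - f z|] for all [y] and [z] near that point. This
    inequality is preserved by bi-Lipschitz changes of coordinates
    ([singular_set_push]). Hence [h], [h * h] and [k] realise the equivalences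
    between the double point sets, their liftings and their images.

    What remains is a question of germs: membership of [x] in the double point
    set computed in [U] may be due to a point [x'] of [U] that is not near 0.
    Finiteness excludes this when [U] is small ([finite_germ_proper]): the
    points of [U] with small image are themselves small. Indeed, if the
    analytic germs are generated by [m] of them as a module over the target
    germs, then the first [m + 1] powers of a coordinate satisfy a relation
    which at [f x = 0] becomes a polynomial equation with constant
    coefficients, and whose error tends to 0 with [f x].

    The regularity of analytic germs is expressed by difference quotients
    ([analytic_difference_quotients]): near 0,
    [u y - u z = \sum_i (y 0 i - z 0 i) * q i (y, z)] with [q i] continuous on
    the diagonal. For monomials this is algebra, with explicit bounds; for a
    power series the quotients of the terms are summed, which requires of the
    ground field that it is complete and that [2^-N] tends to 0. *)

Set Implicit Arguments.
Unset Strict Implicit.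
Unset Printing Implicit Defensive.

Import Order.TTheory GRing.Theory Num.Theory.
Import numFieldNormedType.Exports.

Local Open Scope classical_set_scope.
Local Open Scope ring_scope.

(** * Completeness of the ground field *)

(** Stated with epsilons rather than with the uniform structure of [K]: the
    absolute value of [R[i]] takes its values in [R[i]], and in this form
    completeness passes from [R] to [R[i]] through real and imaginary parts. *)
Definition cauchy_complete (K : numFieldType) : Prop :=
  forall u : nat -> K,
    (forall e : K, 0 < e -> exists N, forall i j, (N <= i)%N -> (N <= j)%N ->
       `|u i - u j| < e) ->
    exists l : K, forall e : K, 0 < e -> exists N, forall i, (N <= i)%N ->
       `|u i - l| < e.

Lemma real_cauchy_complete (R : realType) : cauchy_complete R.
Proof.
move=> u uC.
have cu : cvg (u @ \oo).
  apply/cauchy_cvgP/cauchy_ballP => e e0; near_simpl.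
  have [N NP] := uC _ e0.
  exists ([set k | (N <= k)%N], [set k | (N <= k)%N]) => /=.
    by split; exists N.
  by move=> [i j] /= [Ni Nj]; exact: NP.
exists (lim (u @ \oo)) => e e0.
have /cvgrPdist_lt/(_ _ e0)[N _ NP] := cu.
by exists N => i Ni; rewrite distrC; exact: NP.
Qed.

Lemma norm_complex_le (R : rcfType) (z : R[i]) :
  `|z| <= (`|complex.Re z| + `|complex.Im z|)%:C%C.
Proof.
rewrite {1}(complexE z); apply: le_trans (ler_normD _ _) _.
rewrite normrM !normc_def /= !expr0n !expr1n /= !add0r sqrtr1 !addr0 !sqrtr_sqr.
by rewrite mul1r rmorphD.
Qed.

Lemma norm_Im_le (R : rcfType) (z : R[i]) : (`|complex.Im z|)%:C%C <= `|z|.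
Proof.
rewrite normc_def lecR -sqrtr_sqr ler_sqrt ?addr_ge0 ?sqr_ge0 //.
by rewrite lerDr sqr_ge0.
Qed.

Lemma complex_cauchy_complete (R : realType) :
  cauchy_complete (ground_field R ComplexGround).
Proof.
rewrite /ground_field => u uC.
have part (pr : R[i] -> R) :
    (forall x y, pr (x - y) = pr x - pr y) ->
    (forall z, (`|pr z|)%:C%C <= `|z|) ->
    exists l : R, forall e : R, 0 < e -> exists N, forall i, (N <= i)%N ->
      `|pr (u i) - l| < e.
  move=> prB pr_le; apply: real_cauchy_complete => e e0.
  have [|N NP] := uC e%:C%C; first by rewrite ltcR.
  exists N => i j Ni Nj; rewrite -prB -ltcR.
  exact: le_lt_trans (pr_le _) (NP _ _ Ni Nj).
have [|a aP] := part (@complex.Re R) _ (@normc_ge_Re R); first by case=> ? ? [].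
have [|b bP] := part (@complex.Im R) _ (@norm_Im_le R); first by case=> ? ? [].
exists (a +i* b)%C => e e0.
have eE : (complex.Re e)%:C%C = e by apply: RRe_real; rewrite gtr0_real.
have e20 : 0 < complex.Re e / 2 by rewrite divr_gt0 // -ltcR eE.
have [N NP] := aP _ e20; have [N' NP'] := bP _ e20.
exists (maxn N N') => i; rewrite geq_max => /andP[Ni N'i].
have := @norm_complex_le R (u i - (a +i* b)%C); move/le_lt_trans; apply.
rewrite -eE ltcR [ltRHS]splitr ltrD //.
  by move: (NP _ Ni); case: (u i).
by move: (NP' _ N'i); case: (u i).
Qed.

Lemma ground_field_complete (R : realType) (c : ground) :
  cauchy_complete (ground_field R c).
Proof.
by case: c; [exact: real_cauchy_complete | exact: complex_cauchy_complete].
Qed.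

Lemma ground_field_exp_half (R : realType) (c : ground)
  (e : ground_field R c) : 0 < e -> exists N, 2^-1 ^+ N < e.
Proof.
have halfR (d : R) : 0 < d -> exists N, 2^-1 ^+ N < d.
  move=> d0; exists (Num.Def.archi_bound d^-1).
  rewrite exprVn -[ltRHS]invrK ltf_pV2 ?posrE ?invr_gt0 ?exprn_gt0 //.
  exact: upper_nthrootP.
case: c e => /= e e0; first exact: halfR.
have eE : (complex.Re e)%:C%C = e by apply: RRe_real; rewrite gtr0_real.
have [|N NP] := halfR (complex.Re e); first by rewrite -ltcR eE.
by exists N; rewrite -eE -(ltcR (_ ^+ _)) rmorphXn fmorphV rmorph_nat in NP *.
Qed.

(** All that the power series arguments use of the ground field, so that the
    real and the complex case are treated at once. *)
Definition complete_archimedean (K : numFieldType) : Prop :=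
  cauchy_complete K /\ forall e : K, 0 < e -> exists N, 2^-1 ^+ N < e.

Lemma geometric_limit (K : numFieldType) (u : nat -> K) (M : K) :
  complete_archimedean K ->
  (forall i j, (i <= j)%N -> `|u i - u j| <= M * 2^-1 ^+ i) ->
  exists l, forall i, `|u i - l| <= M * 2^-1 ^+ i.
Proof.
move=> [Kc Ka] uM.
have M0 : 0 <= M.
  by have := uM 0%N 0%N (leqnn _); rewrite subrr normr0 expr0 mulr1.
have small (e : K) : 0 < e -> exists N, M * 2^-1 ^+ N < e.
  move=> e0; have [|N NP] := Ka (e / (M + 1)).
    by rewrite divr_gt0 // ltr_wpDl.
  exists N; have M1 : 0 < M + 1 by rewrite ltr_wpDl.
  rewrite ltr_pdivlMr // mulrC in NP; apply: le_lt_trans NP.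
  by rewrite ler_wpM2r ?exprn_ge0 ?invr_ge0 // lerDl.
have [e e0|l lP] := Kc u.
  have [|N NP] := small (e / 2); first by rewrite divr_gt0.
  exists N => i j Ni Nj; rewrite -(subrKA (u N)); apply: le_lt_trans (ler_normD _ _) _.
  rewrite [ltRHS]splitr (distrC (u i)).
  by rewrite ltrD // (le_lt_trans (uM _ _ _) NP).
exists l => i; apply/ler_addgt0Pr => e e0.
have [N NP] := lP _ e0; rewrite -(subrKA (u (maxn i N))).
apply: le_trans (ler_normD _ _) (lerD (uM _ _ (leq_maxl _ _)) (ltW _)).
by apply: NP; exact: leq_maxr.
Qed.

Lemma ground_field_complete_archimedean (R : realType) (c : ground) :
  complete_archimedean (ground_field R c).
Proof.
split; [exact: ground_field_complete | exact: ground_field_exp_half].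
Qed.

(** * Matrix norms and difference quotients of monomials *)

Lemma coord_le_mx_norm {K : numFieldType} {m n : nat} (x : 'M[K]_(m, n)) i j :
  `|x i j| <= `|x|.
Proof.
rewrite [leRHS]mx_normE -[leLHS]nngE num_le.
by apply: (@le_bigmax _ _ _ _ (fun ij : 'I_m * 'I_n => `|x ij.1 ij.2|%:nng) (i, j)).
Qed.

Lemma mx_norm_le {K : numFieldType} {m n : nat} (x : 'M[K]_(m, n)) (c : K) :
  0 <= c -> (forall i j, `|x i j| <= c) -> `|x| <= c.
Proof.
move=> c0 xc; have [->|/mx_norm_neq0[ij]] := eqVneq (`|x|) 0; first by [].
by rewrite -[mx_norm x]/(`|x|) => ->.
Qed.

Lemma cvg_bigsum {K : numFieldType} {V : normedModType K} {T : Type}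
    {F : set_system T} {FF : Filter F} {I : Type} (r : seq I)
    (f : I -> T -> V) (l : I -> V) :
  (forall i, f i @ F --> l i) ->
  (fun t => \sum_(i <- r) f i t) @ F --> \sum_(i <- r) l i.
Proof.
move=> fl; elim: r => [|i r IH].
  rewrite big_nil (_ : (fun _ => _) = fun=> 0); first exact: cvg_cst.
  by apply/funext => t; rewrite big_nil.
rewrite big_cons (_ : (fun _ => _) = (fun t => f i t + \sum_(j <- r) f j t)).
  exact: cvgD.
by apply/funext => t; rewrite big_cons.
Qed.

Section DifferenceQuotients.
Context {K : numFieldType} {n : nat}.
Implicit Types (u v : 'rV[K]_n -> K) (d : nat).

(** The properties of a monomial of degree [d] that survive summation of a
    power series. The function [q i] plays the role of the [i]-th partial
    derivative, spread over two points; its bound is the one of a derivative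
    of a monomial of degree [d], multiplied by [rho] so as to avoid [d.-1].
    The class is closed under products by the Leibniz rule, hence it contains
    all monomials. *)
Definition growth_with_quotients d u : Prop :=
  [/\ continuous u,
      (forall rho y, `|y| <= rho -> `|u y| <= rho ^+ d) &
      exists q : 'I_n -> 'rV[K]_n * 'rV[K]_n -> K,
        [/\ forall i, continuous (q i),
            forall y z, u y - u z = \sum_i (y 0 i - z 0 i) * q i (y, z) &
            forall rho y z i, `|y| <= rho -> `|z| <= rho ->
              `|q i (y, z)| * rho <= d%:R * rho ^+ d]].

Lemma growth_with_quotients1 : growth_with_quotients 0 (fun=> 1).
Proof.
split; first exact: cst_continuous.
  by move=> rho y _; rewrite normr1.
exists (fun _ _ => 0); split; first by move=> i; exact: cst_continuous.
  by move=> y z; rewrite subrr big1 // => i _; rewrite mulr0.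
by move=> rho y z i _ _; rewrite normr0 !mul0r.
Qed.

Lemma growth_with_quotients_coord (i : 'I_n) :
  growth_with_quotients 1 (fun x => x 0 i).
Proof.
split; first exact: coord_continuous.
  by move=> rho y; apply: le_trans; exact: coord_le_mx_norm.
exists (fun j _ => (j == i)%:R); split; first by move=> j; exact: cst_continuous.
  move=> y z; rewrite (bigD1 i) //= eqxx mulr1 big1 ?addr0 // => j /negPf ->.
  by rewrite mulr0.
move=> rho y z j yr _; have r0 : 0 <= rho := le_trans (normr_ge0 _) yr.
by rewrite normr_nat mul1r ler_piMl // lern1 leq_b1.
Qed.

Lemma growth_with_quotientsM {d e u v} :
  growth_with_quotients d u -> growth_with_quotients e v ->
  growth_with_quotients (d + e) (fun x => u x * v x).
Proof.
move=> [uc ub [p [pc pE pb]]] [vc vb [q [qc qE qb]]]; split.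
- by move=> x; exact: (continuousM (uc x) (vc x)).
- by move=> rho y yr; rewrite normrM exprD ler_pM // ?ub ?vb.
(* Leibniz rule: u y * v y - u z * v z = (u y - u z) * v y + u z * (v y - v z) *)
exists (fun i w => p i w * v w.1 + u w.2 * q i w); split.
- move=> i x.
  have v1 : {for x, continuous (fun w => v w.1)}.
    by apply: continuous_comp; [exact: cvg_fst | exact: vc].
  have u2 : {for x, continuous (fun w => u w.2)}.
    by apply: continuous_comp; [exact: cvg_snd | exact: uc].
  exact: (continuousD (continuousM (pc i x) v1) (continuousM u2 (qc i x))).
- move=> y z /=; under eq_bigr do rewrite mulrDr mulrA mulrCA.
  by rewrite big_split /= -mulr_suml -mulr_sumr -pE -qE; ring.
move=> rho y z i yr zr /=; have r0 : 0 <= rho := le_trans (normr_ge0 _) yr.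
apply: (@le_trans _ _ ((`|p i (y, z)| * rho) * `|v y| + `|u z| * (`|q i (y, z)| * rho))).
  rewrite [leRHS](_ : _ = (`|p i (y, z)| * `|v y| + `|u z| * `|q i (y, z)|) * rho); last by ring.
  by rewrite ler_wpM2r // -!normrM ler_normD.
rewrite natrD mulrDl exprD; apply: lerD.
  by rewrite mulrA ler_pM ?mulr_ge0 ?pb ?vb //.
by rewrite [leRHS]mulrCA ler_pM ?mulr_ge0 ?ub ?qb //.
Qed.

Definition degree (a : {ffun 'I_n -> nat}) : nat := \sum_i a i.

Lemma growth_with_quotients_monomial (a : {ffun 'I_n -> nat}) :
  growth_with_quotients (degree a) (monomial a).
Proof.
rewrite /degree (_ : monomial a = fun x => \prod_(i < n) x 0 i ^+ a i) //.
elim: (index_enum _) => [|i s IH].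
  rewrite big_nil (_ : (fun _ => _) = fun=> 1) //; first exact: growth_with_quotients1.
  by apply/funext => x; rewrite big_nil.
rewrite big_cons (_ : (fun _ => _) = fun x : 'rV[K]_n =>
    x 0 i ^+ a i * \prod_(j <- s) x 0 j ^+ a j).
  2: by apply/funext => x; rewrite big_cons.
apply: growth_with_quotientsM IH.
elim: (a i) => [|k IHk]; first exact: growth_with_quotients1.
rewrite -add1n; have := growth_with_quotientsM (growth_with_quotients_coord i) IHk.
by congr growth_with_quotients; apply/funext => x; rewrite exprS.
Qed.

End DifferenceQuotients.

(** * Difference quotients of power series *)

Section MultiIndices.
Context {n : nat}.
Implicit Types (a : {ffun 'I_n -> nat}) (B : {fset {ffun 'I_n -> nat}}).

(** Boxes exhaust the multi-indices, so unconditional convergence of a power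
    series gives convergence of the sequence of its partial sums over boxes;
    and sums over a box factor into one-variable geometric sums. *)
Definition box (N : nat) : {fset {ffun 'I_n -> nat}} :=
  [fset [ffun i => nat_of_ord (b i)]
   | b : {ffun 'I_n -> 'I_N} in {: {ffun 'I_n -> 'I_N}}]%fset.

Lemma in_box N a : (a \in box N) = [forall i, (a i < N)%N].
Proof.
apply/imfsetP/forallP => [[b _ ->] i|aN]; first by rewrite ffunE.
exists [ffun i => Ordinal (aN i)] => //.
by apply/ffunP => i; rewrite !ffunE.
Qed.

Lemma sub_box B : exists N, (B `<=` box N)%fset.
Proof.
exists (\max_(a <- B) \max_i a i).+1; apply/fsubsetP => a aB.
rewrite in_box; apply/forallP => i; rewrite ltnS.
apply: leq_trans (leq_bigmax i) _.
exact: (@leq_bigmax_seq _ _ xpredT (fun a : {ffun 'I_n -> nat} => \max_i a i)%N).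
Qed.

Lemma box_mono N N' : (N <= N')%N -> (box N `<=` box N')%fset.
Proof.
move=> NN'; apply/fsubsetP => a; rewrite !in_box => /forallP aN.
by apply/forallP => i; exact: leq_trans (aN i) NN'.
Qed.

Lemma degree_notin_box N a : a \notin box N -> (N <= degree a)%N.
Proof.
apply: contraR; rewrite -ltnNge in_box => aN; apply/forallP => i.
by apply: leq_ltn_trans aN; rewrite /degree (bigD1 i) //= leq_addr.
Qed.

Lemma fset_filter_sub {B B'} : (B `<=` B')%fset ->
  [fset a in B' | a \in B]%fset = B.
Proof.
move=> /fsubsetP BB'; apply/fsetP => a; rewrite !inE /= andbC.
by case aB: (a \in B) => //=; exact: BB'.
Qed.

Lemma sum_fset_le {K : numDomainType} {B B'} {F : {ffun 'I_n -> nat} -> K} :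
  (forall a, 0 <= F a) -> (B `<=` B')%fset ->
  \sum_(a <- B) F a <= \sum_(a <- B') F a.
Proof.
move=> F0 BB'; rewrite [leRHS](big_fsetID _ (mem B)) /=.
by rewrite fset_filter_sub // lerDl sumr_ge0.
Qed.

(** A finite set of multi-indices lies in a box, over which the sum of
    [2^-deg a] is the [n]-th power of a geometric sum bounded by 2. *)
Lemma sum_half_degree_le (K : numFieldType) B :
  \sum_(a <- B) (2^-1 : K) ^+ degree a <= 2 ^+ n.
Proof.
have [N BN] := sub_box B.
have half0 k : 0 <= (2^-1 : K) ^+ k by rewrite exprn_ge0 ?invr_ge0.
apply: le_trans (sum_fset_le (fun a => half0 (degree a)) BN) _.
rewrite big_imfset /=; last first.
  move=> b b' _ _ /ffunP bb'; apply/ffunP => i; apply/val_inj.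
  by have := bb' i; rewrite !ffunE.
rewrite big_enum /= (eq_bigr (fun b : {ffun 'I_n -> 'I_N} =>
  \prod_i (2^-1 : K) ^+ b i)); last first.
  by move=> b _; rewrite prodrXr; congr (_ ^+ _); apply: eq_bigr => i _; rewrite ffunE.
rewrite -(bigA_distr_bigA (fun _ (k : 'I_N) => (2^-1 : K) ^+ k)) /=.
rewrite -[in leRHS](card_ord n) -prodr_const.
apply: ler_prod => i _; rewrite sumr_ge0 //=.
suff -> : \sum_(k < N) (2^-1 : K) ^+ k = 2 - 2 * 2^-1 ^+ N.
  by rewrite gerBl mulr_ge0.
elim: N {BN} => [|N IH]; first by rewrite big_ord0 expr0 mulr1 subrr.
by rewrite big_ord_recr /= IH exprS; field.
Qed.

(** Outside [box N] the degree is at least [N], so half of the decay of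
    [4^-deg a] pays for the factor [2^-N], and the other half for the sum. *)
Lemma sum_quarter_degree_le (K : numFieldType) B N :
  (forall a, a \in B -> a \notin box N) ->
  \sum_(a <- B) (4^-1 : K) ^+ degree a <= 2 ^+ n * 2^-1 ^+ N.
Proof.
move=> BN.
apply: (@le_trans _ _ (\sum_(a <- B) (2^-1 : K) ^+ degree a * 2^-1 ^+ N)).
  rewrite big_seq [leRHS]big_seq; apply: ler_sum => a aB.
  rewrite (_ : 4 = 2 * 2) ?invfM ?exprMn; last by rewrite -natrM.
  rewrite ler_wpM2l ?exprn_ge0 // ler_wiXn2l ?invr_ge0 ?invf_le1 ?ler1n //.
  exact: degree_notin_box (BN _ aB).
by rewrite -mulr_suml ler_wpM2r ?exprn_ge0 // sum_half_degree_le.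
Qed.

End MultiIndices.

Section PowerSeries.
Context {K : numFieldType} {n : nat}.
Implicit Types (a : {ffun 'I_n -> nat}) (c : {ffun 'I_n -> nat} -> K).

(** Abel's lemma: the terms of a convergent series are bounded. Adding a
    single index to a set of indices that already gives the sum within 1
    changes it by at most 2; the other indices are finitely many. *)
Lemma coefficients_bounded c (r s : K) :
  0 < r -> power_series_cvg c (const_mx r : 'rV_n) s ->
  exists2 M, 0 < M & forall a, `|c a| * r ^+ degree a <= M.
Proof.
move=> r0 /(_ 1 ltr01)[A AP].
have normE a : `|c a * monomial a (const_mx r : 'rV_n)| = `|c a| * r ^+ degree a.
  rewrite normrM /monomial; congr (_ * _).
  under eq_bigr do rewrite mxE.
  by rewrite prodrXr gtr0_norm // exprn_gt0.
have term0 a : 0 <= `|c a| * r ^+ degree a by rewrite -normE.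
exists (2 + \sum_(a <- A) `|c a| * r ^+ degree a).
  by rewrite ltr_wpDr // sumr_ge0.
move=> a; have [aA|aA] := boolP (a \in A).
  by rewrite (big_fsetD1 _ aA) /= addrCA lerDl addr_ge0 // sumr_ge0.
apply: ler_wpDr; first by rewrite sumr_ge0.
have := AP _ (fsubsetU1 a A); rewrite big_fsetU1 // /= => lt1.
have := AP _ (fsubset_refl A) => lt1'.
rewrite -normE; set t := c a * _; set S := \sum_(_ <- _) _ in lt1 lt1' *.
rewrite (_ : t = (s - S) - (s - (t + S))); last by ring.
apply: le_trans (ler_normB _ _) _.
by rewrite (natrD _ 1 1) lerD // ltW.
Qed.

(** A power series inherits difference quotients from its monomials. If the
    coefficients are at most [M * r ^- deg a], then on the ball of radius
    [r / 8] the quotient of the term of index [a] is at most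
    [M / rho * deg a * 8^-deg a <= M / rho * 4^-deg a], so that the sums of
    quotients over boxes converge uniformly, at a geometric rate. *)
Lemma analytic_difference_quotients (u : 'rV[K]_n -> K) :
  complete_archimedean K -> analytic_fun_germ u ->
  exists (rho : K) (q : 'I_n -> 'rV[K]_n * 'rV[K]_n -> K),
    [/\ 0 < rho,
        forall y z, `|y| < rho -> `|z| < rho ->
          u y - u z = \sum_i (y 0 i - z 0 i) * q i (y, z) &
        forall i x, `|x| < rho -> {for (x, x), continuous (q i)}].
Proof.
move=> Kca [c /nbhs_ballP[e /= e0 cP]].
have [Kc Ka] := Kca.
have ballE (x : 'rV[K]_n) : ball 0 e x = (`|x| < e).
  by rewrite -ball_normE /ball_ /= sub0r normrN.
pose r := e / 2.
have r0 : 0 < r by rewrite divr_gt0.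
have re : r < e by rewrite ltr_pdivrMr // ltr_pMr // ltr1n.
have [|M M0 cM] := @coefficients_bounded c r (u (const_mx r)) r0.
  apply: cP; rewrite ballE; apply: le_lt_trans re.
  by apply: mx_norm_le => [|i j]; rewrite ?mxE ?gtr0_norm // ltW.
(* 8 = 2 * 4, where 2^-deg a absorbs the factor deg a *)
pose rho := r / 8.
have rho0 : 0 < rho by rewrite divr_gt0.
have rhoe : rho < e.
  by apply: lt_trans re; rewrite ltr_pdivrMr // ltr_pMr // ltr1n.
have ex_q a : exists q : 'I_n -> 'rV[K]_n * 'rV[K]_n -> K,
    [/\ forall i, continuous (q i),
    forall y z, monomial a y - monomial a z = \sum_i (y 0 i - z 0 i) * q i (y, z) &
    forall rho y z i, `|y| <= rho -> `|z| <= rho ->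
              `|q i (y, z)| * rho <= (degree a)%:R * rho ^+ degree a].
  by have [_ _ [q qP]] := growth_with_quotients_monomial (K := K) a; exists q.
have [q qP] := boolp.choice ex_q.
have cq_le a i w : `|w.1| <= rho -> `|w.2| <= rho ->
    `|c a * q a i w| <= M / rho * 4^-1 ^+ degree a.
  case: w => y z /= yr zr; have [_ _ /(_ _ _ _ i yr zr) qle] := qP a.
  rewrite -(ler_pM2r rho0) normrM -mulrA.
  apply: le_trans (ler_wpM2l (normr_ge0 _) qle) _.
  rewrite mulrAC divfK ?gt_eqF //.
  apply: (@le_trans _ _ (`|c a| * r ^+ degree a * 4^-1 ^+ degree a)); last first.
    by rewrite ler_wpM2r ?exprn_ge0 ?invr_ge0.
  rewrite -mulrA ler_wpM2l // /rho exprMn [leLHS]mulrCA ler_wpM2l ?exprn_ge0 ?(ltW r0) //.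
  rewrite (_ : 8 = 2 * 4) ?invfM ?exprMn ?mulrA; last by rewrite -natrM.
  rewrite ler_piMl ?exprn_ge0 ?invr_ge0 // exprVn.
  by rewrite ler_pdivrMr ?exprn_gt0 // mul1r -natrX ler_nat ltnW // ltn_expl.
pose Q N i w := \sum_(a <- box N) c a * q a i w.
pose C := M / rho * 2 ^+ n.
have QB i w : `|w.1| <= rho -> `|w.2| <= rho ->
    forall N N', (N <= N')%N -> `|Q N i w - Q N' i w| <= C * 2^-1 ^+ N.
  move=> w1 w2 N N' NN'; rewrite distrC /Q (big_fsetID _ (mem (box N)) (box N')) /=.
  rewrite (fset_filter_sub (box_mono NN')).
  rewrite addrC addrK; apply: le_trans (ler_norm_sum _ _ _) _.
  apply: (@le_trans _ _ (\sum_(a <- [fset x in box N' | x \notin box N]%fset)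
     M / rho * 4^-1 ^+ degree a)).
    by apply: ler_sum => a _; exact: cq_le.
  rewrite -mulr_sumr /C -[leRHS]mulrA ler_wpM2l ?divr_ge0 ?(ltW M0) ?(ltW rho0) ?(ltW e0) //.
  by apply: sum_quarter_degree_le => a; rewrite !inE => /andP[].
have ex_p (iw : 'I_n * ('rV[K]_n * 'rV[K]_n)) : exists p : K,
    `|iw.2.1| <= rho -> `|iw.2.2| <= rho ->
    forall N, `|Q N iw.1 iw.2 - p| <= C * 2^-1 ^+ N.
  case: iw => i w; have [w1|w1] := boolP (`|w.1| <= rho); last first.
    by exists 0 => /= w1'; case/negP: w1.
  have [w2|w2] := boolP (`|w.2| <= rho); last first.
    by exists 0 => /= _ w2'; case/negP: w2.
  by have [l lP] := geometric_limit Kca (QB i w w1 w2); exists l.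
have [p pP] := boolp.choice ex_p.
have C0 : 0 <= C by rewrite mulr_ge0 ?divr_ge0 ?exprn_ge0 // ltW.
have small d : 0 < d -> exists N, C * 2^-1 ^+ N < d.
  move=> d0; have C1 : 0 < C + 1 by rewrite ltr_wpDl.
  have [|N NP] := Ka (d / (C + 1)); first by rewrite divr_gt0.
  exists N; rewrite ltr_pdivlMr // mulrC in NP; apply: le_lt_trans NP.
  by rewrite ler_wpM2r ?exprn_ge0 ?invr_ge0 // lerDl.
exists rho, (fun i w => p (i, w)); split => //.
  move=> y z /ltW yr /ltW zr.
  pose s N (x : 'rV[K]_n) := \sum_(a <- box N) c a * monomial a x.
  have s_cvg x : `|x| <= rho -> s ^~ x @ \oo --> u x.
    move=> xr; apply/cvgrPdist_lt => d d0.
    have [|A AP] := cP x _ d d0; first by rewrite ballE (le_lt_trans xr).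
    have [N AN] := sub_box A; exists N => // N' /= NN'.
    by apply: AP; exact: fsubset_trans AN (box_mono NN').
  have Q_cvg i : (fun N => Q N i (y, z)) @ \oo --> p (i, (y, z)).
    apply/cvgrPdist_lt => d d0; have [N NP] := small d d0.
    exists N => // N' /= NN'; rewrite distrC.
    apply: le_lt_trans (pP (i, (y, z)) yr zr N') (le_lt_trans _ NP).
    by rewrite ler_wpM2l // ler_wiXn2l ?invr_ge0 ?invf_le1 ?ler1n.
  have sE : (fun N => s N y - s N z) =
            (fun N => \sum_i (y 0 i - z 0 i) * Q N i (y, z)).
    apply/funext => N; rewrite /s -sumrB /Q.
    under [RHS]eq_bigr do rewrite mulr_sumr.
    rewrite exchange_big /=; apply: eq_bigr => a _.
    have [_ qE _] := qP a; rewrite -mulrBr qE mulr_sumr.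
    by apply: eq_bigr => i _; rewrite mulrCA.
  apply: (@cvg_unique K (@norm_hausdorff _ K) ((fun N => s N y - s N z) @ \oo)).
    exact: cvgB (s_cvg y yr) (s_cvg z zr).
  rewrite sE; apply: cvg_bigsum => i; apply: cvgMl_tmp; exact: Q_cvg.
(* A uniform limit of continuous functions is continuous. *)
move=> i x xr; apply/cvgrPdist_lt => d d0.
have d30 : 0 < d / 3 by rewrite divr_gt0.
have [N NP] := small _ d30.
have Qc : {for (x, x), continuous (Q N i)}.
  apply: (cvg_bigsum (f := fun a w => c a * q a i w)
    (l := fun a => c a * q a i (x, x))) => a; apply: cvgMl_tmp.
  by have [qc _ _] := qP a; exact: qc.
have /cvgrPdist_lt/(_ _ d30) Qn := Qc.
have c1 : fst @ (x, x) --> x by exact: cvg_fst.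
have c2 : snd @ (x, x) --> x by exact: cvg_snd.
have x1 := cvgr_norm_lt _ c1 _ xr.
have x2 := cvgr_norm_lt _ c2 _ xr.
near=> w.
have Qw : `|Q N i (x, x) - Q N i w| < d / 3 by near: w; exact: Qn.
have wx : `|Q N i w - p (i, w)| < d / 3.
  apply: le_lt_trans (pP (i, w) _ _ N) NP => /=; apply/ltW.
    by near: w; exact: x1.
  by near: w; exact: x2.
have xx : `|p (i, (x, x)) - Q N i (x, x)| < d / 3.
  by rewrite distrC; apply: le_lt_trans (pP (i, (x, x)) (ltW xr) (ltW xr) N) NP.
rewrite (_ : d = d / 3 + d / 3 + d / 3); last by field.
rewrite -(subrKA (Q N i w)) -(subrKA (Q N i (x, x)) (p _)).
apply: le_lt_trans (ler_normD _ _) (ltrD _ wx).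
exact: le_lt_trans (ler_normD _ _) (ltrD xx Qw).
Unshelve. all: by end_near.
Qed.

End PowerSeries.

(** * Strict differentiability and injective differentials *)

Lemma mulmx_norm_le {K : numFieldType} {m n p : nat} (v : 'M[K]_(m, n))
    (J : 'M[K]_(n, p)) :
  `|v *m J| <= n%:R * `|J| * `|v|.
Proof.
apply: mx_norm_le => [|i j]; first by rewrite !mulr_ge0.
rewrite mxE; apply: le_trans (ler_norm_sum _ _ _) _.
apply: (@le_trans _ _ (\sum_(k < n) `|J| * `|v|)).
  by apply: ler_sum => k _; rewrite normrM mulrC ler_pM // coord_le_mx_norm.
by rewrite sumr_const card_ord -mulrA mulr_natl.
Qed.

Section StrictDerivative.
Context {K : numFieldType} {n p : nat}.
Implicit Types (f : 'rV[K]_n -> 'rV[K]_p) (x : 'rV[K]_n) (J : 'M[K]_(n, p)).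

(** Strict rather than ordinary differentiability at [x]: the two points of
    the increment are free near [x]. Only this form gives lower Lipschitz
    bounds near a point at which the derivative is injective. *)
Definition strict_derivative f x J : Prop :=
  forall e : K, 0 < e -> \forall w \near (x, x),
    `|f w.1 - f w.2 - (w.1 - w.2) *m J| <= e * `|w.1 - w.2|.

(** The condition which, for a locally Lipschitz [f], says that [f] is
    bi-Lipschitz onto its image near [x]. *)
Definition locally_expansive f x : Prop :=
  exists2 C : K, 0 < C & \forall w \near (x, x),
    `|w.1 - w.2| <= C * `|f w.1 - f w.2|.

Lemma near_pair_shift (P : 'rV[K]_n * 'rV[K]_n -> Prop) x :
  (\forall w \near (x, x), P w) -> \forall h \near (0 : 'rV[K]_n), P (h + x, x).
Proof.
move=> xP; suff c : (fun h : 'rV[K]_n => (h + x, x)) @ (0 : 'rV[K]_n) --> (x, x) by exact: c.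
have c1 : (fun h : 'rV[K]_n => h + x) @ (0 : 'rV[K]_n) --> x.
  have : {for (0 : 'rV[K]_n), continuous (fun h : 'rV[K]_n => h + x)}.
    by apply: (@continuousD _ _ _ id (cst x)) => //; exact: cst_continuous.
  by rewrite /prop_for /continuous_at add0r.
exact: (cvg_pair c1 (cvg_cst x)).
Qed.

Lemma strict_derivative_jacobian f x J :
  strict_derivative f x J -> jacobian f x = J.
Proof.
move=> fJ; have dE : 'd f x = mulmxr J :> (_ -> _).
  apply: diff_unique.
    apply/linear_bounded_continuous/linear_boundedP.
    near=> r => y /=; apply: le_trans (mulmx_norm_le _ _) _.
    by rewrite ler_wpM2r //; near: r; exact: nbhs_pinfty_ge.
  apply/eqaddoP => e e0; have := near_pair_shift (fJ e e0).
  apply: filterS => h /=; rewrite addrK.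
  by rewrite /= opprD addrA.
apply/matrixP => i j; rewrite /jacobian mxE dE /=.
by rewrite -rowE mxE.
Unshelve. all: by end_near.
Qed.

(** Differentials act on row vectors from the right, so [row_free J] is the
    injectivity of the differential. If [J] has a right inverse, then
    [`|v| <= C * `|v *m J|], and the error term is absorbed once it is at most
    [`|v| / (2 * C)]. Conversely, along a vector of the kernel of [J] the
    increment of [f] is negligible with respect to that of the variable. *)
Lemma strict_derivative_row_free f x J :
  strict_derivative f x J -> row_free J <-> locally_expansive f x.
Proof.
move=> fJ; split=> [/row_freeP[B JB]|[C C0 xC]].
  have [C C0 BC] : exists2 C : K, 0 < C & forall v : 'rV_n, `|v| <= C * `|v *m J|.
    exists (p%:R * `|B| + 1); first by rewrite ltr_wpDl ?mulr_ge0.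
    move=> v; rewrite -{1}[v]mulmx1 -JB mulmxA.
    apply: le_trans (mulmx_norm_le _ _) _.
    by rewrite ler_wpM2r // lerDl.
  exists (2 * C); first by rewrite mulr_gt0.
  have e0 : 0 < (2 * C)^-1 by rewrite invr_gt0 mulr_gt0.
  apply: filterS (fJ _ e0) => w; set d := w.1 - w.2; set D := f w.1 - f w.2.
  move=> wJ; have dJ : `|d *m J| <= `|D| + (2 * C)^-1 * `|d|.
    rewrite -[d *m J](subKr D); apply: le_trans (ler_normB _ _) _.
    by rewrite lerD2l.
  have := le_trans (BC d) (ler_wpM2l (ltW C0) dJ).
  rewrite mulrDr [X in _ + X](_ : _ = `|d| / 2); last by field; rewrite gt_eqF.
  rewrite {1}(splitr `|d|) lerD2r ler_pdivrMr //.
  by rewrite mulrAC [C * 2]mulrC.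
have [//|Jnf] := boolP (row_free J).
have [v vJ v0] : exists2 v : 'rV_n, v *m J = 0 & v != 0.
  by move: Jnf; rewrite -kermx_eq0 => /rowV0Pn[v /sub_kermxP vJ v0]; exists v.
have e0 : 0 < (2 * C)^-1 by rewrite invr_gt0 mulr_gt0.
have xCe : \forall w \near (x, x), `|w.1 - w.2| <= C * `|f w.1 - f w.2| /\
    `|f w.1 - f w.2 - (w.1 - w.2) *m J| <= (2 * C)^-1 * `|w.1 - w.2|.
  by apply: filterI; [exact: xC | exact: fJ].
have /nbhs_ballP[d /= d0 dP] := near_pair_shift xCe.
pose h := (d / 2 / `|v|) *: v.
have hn : `|h| = d / 2.
  rewrite normrZ ger0_norm ?divr_ge0 ?(ltW d0) //.
  by rewrite divfK // normr_eq0.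
have [|/=] := dP h.
  rewrite -ball_normE /ball_ /= sub0r normrN hn ltr_pdivrMr //.
  by rewrite ltr_pMr // ltr1n.
rewrite addrK => hC; rewrite /h -scalemxAl vJ scaler0 subr0 -/h => hD.
have := le_trans hC (ler_wpM2l (ltW C0) hD).
rewrite hn [leRHS](_ : _ = d / 2 * 2^-1); last by field; rewrite gt_eqF.
by rewrite ler_pdivlMr // ger_pMr ?divr_gt0 // lern1.
Unshelve. all: by end_near.
Qed.

End StrictDerivative.

(** * Regularity of analytic germs *)

Section AnalyticRegularity.
Context {K : numFieldType} {n p : nat}.
Hypothesis Kca : complete_archimedean K.

Lemma near_norm_lt {V : normedModType K} (rho : K) :
  0 < rho -> \forall x \near (0 : V), `|x| < rho.
Proof.
by move=> rho0; apply: (cvgr_norm_lt (0 : V)); [exact: cvg_id | rewrite normr0].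
Qed.

Lemma analytic_continuous0 (u : 'rV[K]_n -> K) :
  analytic_fun_germ u -> {for 0, continuous u}.
Proof.
move=> /(analytic_difference_quotients Kca)[rho [q [rho0 uE qc]]].
have q0 i : (fun y : 'rV[K]_n => q i (y, 0)) @ (0 : 'rV[K]_n) --> q i (0, 0).
  apply: (continuous_comp (f := fun y : 'rV[K]_n => (y, 0 : 'rV[K]_n))).
    have c1 : (fun y : 'rV[K]_n => y) @ (0 : 'rV[K]_n) --> (0 : 'rV[K]_n).
      exact: cvg_id.
    exact: (cvg_pair c1 (cvg_cst (0 : 'rV[K]_n))).
  by apply: qc; rewrite normr0.
have : (fun y : 'rV[K]_n => u 0 + \sum_i y 0 i * q i (y, 0)) @ (0 : 'rV[K]_n)
    --> u 0 + \sum_i (0 : 'rV[K]_n) 0 i * q i (0, 0).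
  have yq i : (fun y : 'rV[K]_n => y 0 i * q i (y, 0)) @ (0 : 'rV[K]_n)
      --> (0 : 'rV[K]_n) 0 i * q i (0, 0).
    have y0 : (fun y : 'rV[K]_n => y 0 i) @ (0 : 'rV[K]_n) --> (0 : 'rV[K]_n) 0 i.
      exact: coord_continuous.
    exact: cvgM y0 (q0 i).
  have sq := @cvg_bigsum K K _ _ (nbhs_filter (0 : 'rV[K]_n)) _ (index_enum 'I_n) _ _ yq.
  exact: cvgD (cvg_cst (u 0)) sq.
rewrite big1 => [|i _]; last by rewrite mxE mul0r.
rewrite addr0 => s0.
have uq : \forall y \near (0 : 'rV[K]_n),
    (fun y : 'rV[K]_n => u 0 + \sum_i y 0 i * q i (y, 0)) y = u y.
  apply: filterS (near_norm_lt rho0) => y yrho.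
  rewrite -[RHS](subrK (u 0)) addrC uE ?normr0 //; congr (_ + _).
  by apply: eq_bigr => i _; rewrite mxE subr0.
exact: cvg_trans (near_eq_cvg uq) s0.
Qed.

(** The derivative at [x] is the matrix of the values at [(x, x)] of the
    difference quotients of the coordinates of [f]. *)
Lemma analytic_strict_derivative (f : 'rV[K]_n -> 'rV[K]_p) :
  analytic_map_germ f ->
  \forall x \near (0 : 'rV[K]_n), exists J, strict_derivative f x J.
Proof.
move=> [_ fa].
have fj j : \forall x \near (0 : 'rV[K]_n), exists l : 'I_n -> K, forall e, 0 < e ->
    \forall w \near (x, x), `|f w.1 0 j - f w.2 0 j -
      \sum_i (w.1 - w.2) 0 i * l i| <= e * `|w.1 - w.2|.
  have [rho [q [rho0 uE qc]]] := analytic_difference_quotients Kca (fa j).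
  apply: filterS (near_norm_lt rho0) => x xrho.
  exists (fun i => q i (x, x)) => e e0.
  have c1 : fst @ (x, x) --> x by exact: cvg_fst.
  have c2 : snd @ (x, x) --> x by exact: cvg_snd.
  have x1 := cvgr_norm_lt _ c1 _ xrho; have x2 := cvgr_norm_lt _ c2 _ xrho.
  have en : 0 < e / n.+1%:R by rewrite divr_gt0.
  have qn : \forall w \near (x, x), forall i, `|q i (x, x) - q i w| < e / n.+1%:R.
    have qni i : \forall w \near (x, x), `|q i (x, x) - q i w| < e / n.+1%:R.
      by have /cvgrPdist_lt := qc i x xrho; exact.
    exact: filter_forall _ qni.
  near=> w.
  have w1 : `|w.1| < rho by near: w; exact: x1.
  have w2 : `|w.2| < rho by near: w; exact: x2.
  have wq : forall i, `|q i (x, x) - q i w| < e / n.+1%:R by near: w; exact: qn.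
  rewrite uE // -sumrB; apply: le_trans (ler_norm_sum _ _ _) _.
  apply: (@le_trans _ _ (\sum_(i < n) `|w.1 - w.2| * (e / n.+1%:R))).
    apply: ler_sum => i _; rewrite [(w.1 - w.2) 0 i]mxE [(- w.2) 0 i]mxE.
    rewrite -mulrBr normrM ler_pM //.
      by have := coord_le_mx_norm (w.1 - w.2) 0 i; rewrite !mxE.
    by rewrite distrC -surjective_pairing ltW.
  rewrite sumr_const card_ord -mulrnAr mulrC ler_wpM2r // -mulrnAr.
  by rewrite ler_piMr ?(ltW e0) // -mulr_natl ler_pdivrMr // mul1r ler_nat.
have := filter_forall (nbhs_filter (0 : 'rV[K]_n)) fj; apply: filterS => x /boolp.choice[l lP].
exists (\matrix_(i, j) l j i) => e e0.
apply: filterS (filter_forall _ (fun j => lP j e e0)) => w wP.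
apply: mx_norm_le => [|i j]; first by rewrite mulr_ge0 // ltW.
rewrite ord1 !mxE; apply: le_trans (wP j).
by rewrite (eq_bigr (fun k => (w.1 - w.2) 0 k * l j k)) // => k _; rewrite !mxE.
Unshelve. all: by end_near.
Qed.

(** A metric description of the singular set, from which its bi-Lipschitz
    invariance will follow. *)
Lemma singular_iff_not_expansive (f : 'rV[K]_n -> 'rV[K]_p) :
  (n <= p)%N -> analytic_map_germ f ->
  \forall x \near (0 : 'rV[K]_n), singular_set f x <-> ~ locally_expansive f x.
Proof.
move=> np fa; apply: filterS (analytic_strict_derivative fa) => x [J xJ].
rewrite -(strict_derivative_row_free xJ) /singular_set /= (strict_derivative_jacobian xJ).
rewrite (minn_idPl np) /row_free ltn_neqAle rank_leq_row andbT.
by split=> [/negP|/negP].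
Qed.

End AnalyticRegularity.

(** * Finite germs *)

Section FiniteGerms.
Context {K : numFieldType} {n p : nat}.
Hypothesis Kca : complete_archimedean K.

Lemma analytic_coord_power (j : 'I_n) (k : nat) :
  analytic_fun_germ (fun x : 'rV[K]_n => x 0 j ^+ k).
Proof.
pose a0 : {ffun 'I_n -> nat} := [ffun i => if i == j then k else 0%N].
exists (fun a => (a == a0)%:R); apply: (filterE (F := nbhs (0 : 'rV[K]_n))) => x e e0.
exists [fset a0]%fset => B; rewrite fsub1set => a0B.
rewrite (big_fsetD1 _ a0B) /= eqxx mul1r big_seq big1 ?addr0 => [|a]; last first.
  by rewrite !inE => /andP[/negPf -> _]; rewrite mul0r.
rewrite /monomial (bigD1 j) //= ffunE eqxx big1 ?mulr1 ?subrr ?normr0 // => i.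
by rewrite ffunE => /negPf ->.
Qed.

Lemma mx_norm_lt {m l : nat} (x : 'M[K]_(m, l)) (e : K) :
  0 < e -> (forall i j, `|x i j| < e) -> `|x| < e.
Proof.
move=> e0 xe; have [->|/mx_norm_neq0[ij]] := eqVneq (`|x|) 0; first by [].
by rewrite -[mx_norm x]/(`|x|) => ->.
Qed.

(** The fibres over points near 0, taken in [U], shrink to 0. In particular
    a zero of [f] in [U] can only be 0. *)
Definition proper_on (f : 'rV[K]_n -> 'rV[K]_p) (U : set 'rV[K]_n) : Prop :=
  forall e : K, 0 < e ->
    \forall y \near (0 : 'rV[K]_p), forall x, U x -> f x = y -> `|x| < e.

Lemma horner_continuous (q : {poly K}) : continuous (horner q).
Proof.
elim/poly_ind: q => [|q d IH].
  rewrite (_ : horner 0 = fun=> 0); first exact: cst_continuous.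
  by apply/funext => t; rewrite horner0.
rewrite (_ : horner _ = fun t => q.[t] * t + d).
  move=> t; have id_t : {for t, continuous (fun s : K => s)} by exact: cvg_id.
  have cst_t : {for t, continuous (fun _ : K => d)} by exact: cst_continuous.
  exact: (continuousD (continuousM (IH t) id_t) cst_t).
by apply/funext => t; rewrite hornerMXaddC.
Qed.

(** Let [t] be the [j]-th coordinate. The [m + 1] functions [1, t, ..., t ^ m]
    are combinations of the [m] generators [a i], with coefficients that are
    functions [b k i] of [f x]. At [f x = 0] the rows of coefficients satisfy a
    linear relation [w], so that the nonzero polynomial [P] with coefficients
    [w] takes at [t] a value which tends to 0 with [f x]. Writing
    [P = q * 'X^s] with [q.[0] != 0] shows that [t ^ s], hence [t], is small. *)
Lemma finite_germ_coord_small (f : 'rV[K]_n -> 'rV[K]_p) (j : 'I_n) :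
  finite_map_germ f ->
  exists U : set 'rV[K]_n, nbhs (0 : 'rV[K]_n) U /\ forall e : K, 0 < e ->
    \forall y \near (0 : 'rV[K]_p), forall x, U x -> f x = y -> `|x 0 j| < e.
Proof.
move=> [m [a [aa fin]]].
have [b bP] := boolp.choice (fun k : 'I_m.+1 => fin _ (analytic_coord_power j k)).
pose B0 := \matrix_(k < m.+1, i < m) b k i 0.
(* B0 has more rows than columns. *)
have [w wB w0] : exists2 w : 'rV_m.+1, w *m B0 = 0 & w != 0.
  have : ~~ row_free B0 by rewrite /row_free neq_ltn ltnS rank_leq_col.
  by rewrite -kermx_eq0 => /rowV0Pn[w /sub_kermxP wB w0]; exists w.
pose P : {poly K} := rVpoly w.
have P0 : P != 0.
  by apply: contra_neq w0 => P0; rewrite -[w]rVpolyK -/P P0 linear0.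
have PE t : P.[t] = \sum_(k < m.+1) w 0 k * t ^+ k.
  rewrite /P /rVpoly horner_poly; apply: eq_bigr => k _.
  by rewrite valK.
have [s [q]] := multiplicity_XsubC P 0; rewrite P0 /= rootE subr0 => q0 Pq.
pose A := \sum_i `|a i 0| + 1.
pose c := `|q.[0]| / 2.
have c0 : 0 < c by rewrite divr_gt0 // normr_gt0.
pose U := [set x : 'rV[K]_n | [/\ forall k : 'I_m.+1, x 0 j ^+ k = \sum_(i < m) b k i (f x) * a i x,
   forall i, `|a i x| < A & c < `|q.[x 0 j]| ]].
exists U; split.
  have U1 := filter_forall (nbhs_filter (0 : 'rV[K]_n)) (fun k => (bP k).2).
  have U2 : \forall x \near (0 : 'rV[K]_n), forall i, `|a i x| < A.
    have U2i i : \forall x \near (0 : 'rV[K]_n), `|a i x| < A.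
      apply: cvgr_norm_lt (analytic_continuous0 Kca (aa i)) _ _.
      rewrite /A (bigD1 i) //= -addrA ltrDl.
      by rewrite ltr_wpDl // sumr_ge0.
    exact: filter_forall _ U2i.
  have U3 : \forall x \near (0 : 'rV[K]_n), c < `|q.[(x : 'rV[K]_n) 0 j]|.
    have qc : {for (0 : 'rV[K]_n), continuous (fun x : 'rV[K]_n => q.[x 0 j])}.
      apply: continuous_comp; first exact: coord_continuous.
      exact: horner_continuous.
    apply: (cvgr_norm_gt _ qc).
    by rewrite mxE /c ltr_pdivrMr // ltr_pMr ?normr_gt0 // ltr1n.
  near=> x; split; [near: x; exact: U1|near: x; exact: U2|near: x; exact: U3].
move=> e e0.
pose S y := \sum_(k < m.+1) \sum_(i < m) `|w 0 k| * `|b k i y - b k i 0|.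
have A0 : 0 < A by rewrite ltr_wpDl // sumr_ge0.
have S0 : S @ (0 : 'rV[K]_p) --> 0.
  have Ski k i : (fun y => `|w 0 k| * `|b k i y - b k i 0|) @ (0 : 'rV[K]_p) --> 0.
    have [ba _] := bP k.
    have bc := analytic_continuous0 Kca (ba i).
    rewrite -(mulr0 `|w 0 k|) -(normr0 K) -(subrr (b k i 0)).
    exact: cvgMl_tmp (cvg_norm (cvgB bc (cvg_cst (b k i 0)))).
  have Sk k : (fun y => \sum_(i < m) `|w 0 k| * `|b k i y - b k i 0|) @ (0 : 'rV[K]_p) --> 0.
    have := @cvg_bigsum K K _ _ (nbhs_filter (0 : 'rV[K]_p)) _ (index_enum 'I_m) _ _ (Ski k).
    by rewrite big1.
  have := @cvg_bigsum K K _ _ (nbhs_filter (0 : 'rV[K]_p)) _ (index_enum 'I_m.+1) _ _ Sk.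
  by rewrite big1.
have eta0 : 0 < c * e ^+ s / A by rewrite divr_gt0 // mulr_gt0 // exprn_gt0.
have nS : \forall y \near (0 : 'rV[K]_p), `|S y| < c * e ^+ s / A.
  by apply: (cvgr_norm_lt _ S0); rewrite normr0.
apply: filterS nS => y yS x [xb xa xq] fx.
have Px : `|P.[x 0 j]| <= S y * A.
  have -> : P.[x 0 j] = \sum_(k < m.+1) \sum_(i < m) w 0 k * (b k i y - b k i 0) * a i x.
    have w0B : \sum_(k < m.+1) \sum_(i < m) w 0 k * b k i 0 * a i x = 0.
      rewrite exchange_big big1 // => i _; rewrite -mulr_suml.
      have /matrixP/(_ 0 i) := wB; rewrite !mxE => wBi.
      rewrite (_ : \sum_(k < m.+1) _ = 0) ?mul0r // -[RHS]wBi.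
      by apply: eq_bigr => k _; rewrite mxE.
    rewrite PE -[LHS]subr0 -[X in _ - X = _]w0B -sumrB; apply: eq_bigr => k _.
    rewrite (xb k) fx mulr_sumr -sumrB; apply: eq_bigr => i _.
    by rewrite mulrBr mulrBl mulrA.
  rewrite /S mulr_suml; apply: le_trans (ler_norm_sum _ _ _) (ler_sum _ _) => k _.
  rewrite mulr_suml; apply: le_trans (ler_norm_sum _ _ _) (ler_sum _ _) => i _.
  by rewrite !normrM ler_pM ?mulr_ge0 // ltW.
have lt1 : c * `|x 0 j| ^+ s < c * e ^+ s.
  apply: le_lt_trans (_ : `|P.[x 0 j]| < _).
    rewrite Pq hornerM hornerXn normrM normrX.
    by rewrite ler_wpM2r ?exprn_ge0 // ltW.
  apply: le_lt_trans Px _; rewrite -ltr_pdivlMr //.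
  by rewrite -[S y]ger0_norm // sumr_ge0 // => k _; rewrite sumr_ge0 // => i _; rewrite mulr_ge0.
(* This covers s = 0, where lt1 becomes 1 < 1. *)
rewrite ltr_pM2l // in lt1; rewrite real_ltNge ?normr_real ?gtr0_real //.
by apply/negP => /(lerXn2r s (ltW e0) (normr_ge0 _)); rewrite (lt_geF lt1).
Unshelve. all: by end_near.
Qed.

Lemma finite_germ_proper (f : 'rV[K]_n -> 'rV[K]_p) :
  finite_map_germ f -> exists2 U : set 'rV[K]_n, nbhs (0 : 'rV[K]_n) U & proper_on f U.
Proof.
move=> ff.
have [U UP] := boolp.choice (fun j => finite_germ_coord_small j ff).
exists [set x | forall j, U j x].
  have U0 j := (UP j).1; exact: filter_forall _ U0.
move=> e e0; have Uj j := (UP j).2 e e0.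
apply: filterS (filter_forall _ Uj) => y yU x Ux fx.
by apply: mx_norm_lt => // i j; rewrite ord1; exact: yU.
Qed.

End FiniteGerms.

(** * Bi-Lipschitz germs *)

Section Lipschitz.
Context {K : numFieldType} {V W : normedModType K}.

Lemma lipschitz_inP (h : V -> W) (U : set V) :
  [lipschitz h x | x in U] <->
  exists2 M : K, 0 < M & forall x y, U x -> U y -> `|h x - h y| <= M * `|x - y|.
Proof.
split=> [/pinfty_ex_gt0[M M0 hM]|[M M0 hM]].
  by exists M => // x y Ux Uy; exact: (hM (x, y) (conj Ux Uy)).
exists M; split=> [|k Mk]; first exact: gtr0_real.
move=> [x y] [/= Ux Uy]; apply: le_trans (hM x y Ux Uy) _.
by rewrite ler_wpM2r // ltW.
Qed.

Lemma lipschitz_continuous_at (h : V -> W) (U : set V) (x : V) :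
  open U -> U x -> [lipschitz h y | y in U] -> {for x, continuous h}.
Proof.
move=> oU Ux /lipschitz_inP[M M0 hM]; apply/cvgrPdist_lt => e e0.
have nU : \forall y \near x, U y by exact: open_nbhs_nbhs.
have ne : \forall y \near x, `|x - y| < e / M.
  have /cvgrPdist_lt := @cvg_id _ (nbhs x); apply.
  by rewrite divr_gt0.
apply: filterS2 nU ne => y Uy xy; apply: le_lt_trans (hM _ _ Ux Uy) _.
by rewrite mulrC -ltr_pdivlMr.
Qed.

End Lipschitz.

Section Germs.
Context {K : numFieldType} {E : normedModType K}.
Implicit Types (h hi : E -> E) (U V X Y : set E).

Lemma bilipschitz_germ_sym h hi : bilipschitz_germ h hi -> bilipschitz_germ hi h.
Proof.
move=> [U [V [U0 V0 h0 [hU hV hL hiL]]]]; exists V, U; split => //.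
by have [_] := hU 0 U0.2; rewrite h0.
Qed.

Lemma bilipschitz_germ_cvg h hi : bilipschitz_germ h hi -> h @ (0 : E) --> (0 : E).
Proof.
move=> [U [V [U0 _ h0 [_ _ hL _]]]].
have := lipschitz_continuous_at U0.1 U0.2 hL.
by rewrite /prop_for /continuous_at h0.
Qed.

(** To compare germs of sets it suffices to carry each into the other near 0;
    the neighbourhoods on which the images agree exactly are obtained by
    shrinking the domain to an open set where both inclusions hold. *)
Lemma bilipschitz_equiv_set_germs_near h hi X Y :
  bilipschitz_germ h hi ->
  (\forall x \near (0 : E), X x -> Y (h x)) ->
  (\forall y \near (0 : E), Y y -> X (hi y)) ->
  bilipschitz_equiv_set_germs X Y.
Proof.
move=> hb XY YX.
have YXh := bilipschitz_germ_cvg hb YX.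
have [U [V [U0 V0 h0 [hU hV hL hiL]]]] := hb.
have : nbhs (0 : E) [set x | [/\ U x, X x -> Y (h x) & Y (h x) -> X (hi (h x))]].
  have nU : \forall x \near (0 : E), U x by exact: open_nbhs_nbhs.
  near=> x; split; [near: x; exact: nU|near: x; exact: XY|near: x; exact: YXh].
rewrite nbhsE; move=> [B B0 BP].
have BU : B `<=` U by move=> x /BP[].
have hi0 : hi 0 = 0 by have [_] := hU 0 U0.2; rewrite h0.
exists B, (V `&` hi @^-1` B), h, hi; split; first split => //.
- split; last by split; [exact: V0.2 | rewrite /= hi0; exact: B0.2].
  rewrite openE => y [Vy By]; apply: filterI.
    by apply: open_nbhs_nbhs; split; [exact: V0.1|].
  apply: (lipschitz_continuous_at V0.1 Vy hiL).
  by apply: open_nbhs_nbhs; split; [exact: B0.1|].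
- split.
  + move=> x Bx; have [Vhx hK] := hU x (BU x Bx); split => //.
    by split => //=; rewrite hK.
  + by move=> y [Vy By]; split => //; have [] := hV y Vy.
  + move: hL => /lipschitz_inP[M M0 hM]; apply/lipschitz_inP; exists M => // x y Bx By.
    by apply: hM; exact: BU.
  + move: hiL => /lipschitz_inP[M M0 hM]; apply/lipschitz_inP; exists M => // x y [Vx _] [Vy _].
    exact: hM.
apply/seteqP; split=> [y [x [Xx Bx] <-]|y [Yy [Vy By]]].
  have [Ux xXY _] := BP x Bx; have [Vhx hK] := hU x Ux.
  by split; [exact: xXY|split => //=; rewrite hK].
have [_ _] := BP _ By; have [_ hiK] := hV y Vy; rewrite hiK => yYX.
by exists (hi y) => //; split => //; exact: yYX.
Unshelve. all: by end_near.
Qed.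

Lemma prod_norm_le (z : E * E) (c : K) : `|z.1| <= c -> `|z.2| <= c -> `|z| <= c.
Proof. by move=> z1 z2; rewrite prod_normE maxElt; case: ifP. Qed.

Lemma le_prod_norm (z : E * E) : `|z.1| <= `|z| /\ `|z.2| <= `|z|.
Proof.
by rewrite prod_normE; case: (real_ltP (normr_real z.1) (normr_real z.2)) => // /ltW.
Qed.

Lemma bilipschitz_germ_square h hi :
  bilipschitz_germ h hi ->
  bilipschitz_germ (fun z : E * E => (h z.1, h z.2)) (fun z => (hi z.1, hi z.2)).
Proof.
have square_lipschitz (u : E -> E) (U : set E) : [lipschitz u x | x in U] ->
    [lipschitz (u z.1, u z.2) | z in U `*` U].
  move=> /lipschitz_inP[M M0 uM]; apply/lipschitz_inP; exists M => // x y [x1 x2] [y1 y2].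
  have [n1 n2] := le_prod_norm (x - y).
  apply: prod_norm_le => /=.
    by apply: le_trans (uM _ _ x1 y1) _; rewrite ler_pM2l.
  by apply: le_trans (uM _ _ x2 y2) _; rewrite ler_pM2l.
have square_open (U : set E) : open_nbhs 0 U -> open_nbhs (0 : E * E) (U `*` U).
  move=> [oU U0]; split; last by split.
  rewrite openE => -[x y] [/= Ux Uy]; exists (U, U) => //.
  by split; apply: open_nbhs_nbhs; split.
move=> [U [V [U0 V0 h0 [hU hV hL hiL]]]].
exists (U `*` U), (V `*` V); split; [exact: square_open|exact: square_open| |].
  by rewrite /= h0.
split; [| |exact: square_lipschitz|exact: square_lipschitz].
  by move=> [x y] [/= /hU[hx ->] /hU[hy ->]].
by move=> [x y] [/= /hV[hx ->] /hV[hy ->]].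
Qed.

End Germs.

(** * Invariance of the double point sets *)

Lemma near_pair {T U : topologicalType} (P : T -> Prop) (Q : U -> Prop) (x : T) (y : U) :
  (\forall t \near x, P t) -> (\forall t \near y, Q t) ->
  \forall w \near (x, y), P w.1 /\ Q w.2.
Proof. by move=> xP yQ; exists (P, Q) => // -[t u] []. Qed.

Section Transfer.
Context {K : numFieldType} {n p : nat}.
Hypothesis Kca : complete_archimedean K.
Implicit Types f g : 'rV[K]_n -> 'rV[K]_p.

Lemma analytic_map_cvg0 f :
  analytic_map_germ f -> f @ (0 : 'rV[K]_n) --> (0 : 'rV[K]_p).
Proof.
move=> [f0 fa].
apply/(cvgrPdist_lt (FF := nbhs_filter (0 : 'rV[K]_n))) => e e0.
have fj j : \forall x \near (0 : 'rV[K]_n), `|f x 0 j| < e.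
  by apply: cvgr_norm_lt (analytic_continuous0 Kca (fa j)) _ _; rewrite f0 mxE normr0.
have := filter_forall (nbhs_filter (0 : 'rV[K]_n)) fj; apply: filterS => x xe.
rewrite sub0r normrN.
by apply: mx_norm_lt => // i j; rewrite ord1.
Qed.

(** The conjugacy in a form invariant under exchanging [f] with [g], [h] with
    [hi] and [k] with [ki]: what is proved of [f] and [g] below then holds of
    [g] and [f] as well. *)
Lemma bilipschitz_A_equiv_conj f g :
  analytic_map_germ f -> bilipschitz_A_equiv f g ->
  exists (h hi : 'rV[K]_n -> 'rV[K]_n) (k ki : 'rV[K]_p -> 'rV[K]_p),
    [/\ bilipschitz_germ h hi, bilipschitz_germ k ki,
        \forall x \near (0 : 'rV[K]_n), g (h x) = k (f x) &
        \forall y \near (0 : 'rV[K]_n), f (hi y) = ki (g y)].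
Proof.
move=> fa [h [hi [k [ki [hb kb gE]]]]]; exists h, hi, k, ki; split=> //.
  have gEh : \forall x \near (0 : 'rV[K]_n), g (h x) = k (f (hi (h x))).
    exact: (bilipschitz_germ_cvg hb gE).
  have [U [V [U0 V0 h0 [hU _ _ _]]]] := hb.
  have nU : \forall x \near (0 : 'rV[K]_n), U x by exact: open_nbhs_nbhs.
  by apply: filterS2 nU gEh => x /hU[_ hK] /= ->; rewrite hK.
have [U [V [U0 V0 k0 [kU _ _ _]]]] := kb.
have nU : \forall x \near (0 : 'rV[K]_p), U x by exact: open_nbhs_nbhs.
have nfU : \forall y \near (0 : 'rV[K]_n), U (f (hi y)).
  exact: (bilipschitz_germ_cvg (bilipschitz_germ_sym hb) (analytic_map_cvg0 fa nU)).
by apply: filterS2 nfU gE => y /= /kU[_ kK] ->; rewrite kK.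
Qed.

Section Forward.
Variables (f g : 'rV[K]_n -> 'rV[K]_p).
Variables (h hi : 'rV[K]_n -> 'rV[K]_n) (k ki : 'rV[K]_p -> 'rV[K]_p).
Hypotheses (fa : analytic_map_germ f) (ga : analytic_map_germ g).
Hypotheses (hb : bilipschitz_germ h hi) (kb : bilipschitz_germ k ki).
Hypothesis ghE : \forall x \near (0 : 'rV[K]_n), g (h x) = k (f x).

(** For [y] and [z] near [x], [`|y - z|] is controlled by [`|h y - h z|], this
    by [`|g (h y) - g (h z)| = `|k (f y) - k (f z)|], and this by
    [`|f y - f z|]. *)
Lemma locally_expansive_pullback :
  \forall x \near (0 : 'rV[K]_n), locally_expansive g (h x) -> locally_expansive f x.
Proof.
have [U [V [U0 V0 h0 [hU hV hL hiL]]]] := hb.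
have [U' [V' [U'0 V'0 k0 [kU kV kL kiL]]]] := kb.
have [Mi Mi0 hiM] := (lipschitz_inP _ _).1 hiL.
have [Mk Mk0 kM] := (lipschitz_inP _ _).1 kL.
have nU : \forall x \near (0 : 'rV[K]_n), U x by exact: open_nbhs_nbhs.
have nU' : \forall x \near (0 : 'rV[K]_n), U' (f x).
  exact: (analytic_map_cvg0 fa (open_nbhs_nbhs U'0)).
pose P x := [/\ U x, U' (f x) & g (h x) = k (f x)].
have nP : \forall x \near (0 : 'rV[K]_n), P x.
  by near=> x; split; [near: x; exact: nU|near: x; exact: nU'|near: x; exact: ghE].
apply: filterS (near_join nP) => x xP [C C0 gC].
have [Ux _ _] := nbhs_singleton xP.
have hx := lipschitz_continuous_at U0.1 Ux hL.
have hhx : (fun w : 'rV[K]_n * 'rV[K]_n => (h w.1, h w.2)) @ (x, x) --> (h x, h x).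
  have c1 : {for (x, x), continuous (fun w => h w.1)}.
    by apply: continuous_comp; [exact: cvg_fst | exact: hx].
  have c2 : {for (x, x), continuous (fun w => h w.2)}.
    by apply: continuous_comp; [exact: cvg_snd | exact: hx].
  exact: (cvg_pair c1 c2).
exists (Mi * C * Mk); first by rewrite !mulr_gt0.
apply: filterS2 (near_pair xP xP) (hhx _ gC) => -[y z] /= [[Uy U'y yE] [Uz U'z zE]] yz.
have [[Vy yK] [Vz zK]] := (hU y Uy, hU z Uz).
rewrite -{1}yK -{1}zK; apply: le_trans (hiM _ _ Vy Vz) _.
rewrite -!mulrA ler_wpM2l ?(ltW Mi0) //; apply: le_trans yz _.
by rewrite ler_wpM2l ?(ltW C0) // yE zE; exact: kM.
Unshelve. all: by end_near.
Qed.

(** Contrapositive of the previous lemma, singular points being those where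
    the map is not expansive. *)
Lemma singular_set_push :
  (n <= p)%N ->
  \forall x \near (0 : 'rV[K]_n), singular_set f x -> singular_set g (h x).
Proof.
move=> np; have gs : \forall x \near (0 : 'rV[K]_n),
    singular_set g (h x) <-> ~ locally_expansive g (h x).
  exact: (bilipschitz_germ_cvg hb (singular_iff_not_expansive Kca np ga)).
have fs := singular_iff_not_expansive Kca np fa.
apply: filterS3 gs fs locally_expansive_pullback => x /= gs fs fg.
by rewrite fs gs => nf /fg.
Qed.

Let transported (W : set 'rV[K]_n) x :=
  [/\ W (h x), hi (h x) = x & g (h x) = k (f x)].

Let near_transported (W : set 'rV[K]_n) :
  open_nbhs (0 : 'rV[K]_n) W -> \forall x \near (0 : 'rV[K]_n), transported W x.
Proof.
move=> W0; have [U [V [U0 V0 h0 [hU hV hL hiL]]]] := hb.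
have nW : \forall x \near (0 : 'rV[K]_n), W (h x).
  exact: (bilipschitz_germ_cvg hb (open_nbhs_nbhs W0)).
have nU : \forall x \near (0 : 'rV[K]_n), U x by exact: open_nbhs_nbhs.
by apply: filterS3 nW nU ghE => x Wx /hU[_ hK] gE; split.
Qed.

(** A point [x' != x] with [f x' = f x] is only known to lie in [U], while [h]
    is under control near 0 only. As [x] tends to 0 so does [f x], and by
    properness [x'] is then near 0 as well. *)
Lemma double_points_push (U0 U W : set 'rV[K]_n) :
  (n <= p)%N -> proper_on f U0 -> U `<=` U0 -> open_nbhs (0 : 'rV[K]_n) W ->
  \forall x \near (0 : 'rV[K]_n), double_points f U x -> double_points g W (h x).
Proof.
move=> np fU0 UU0 W0.
have ng := near_transported W0.
have /nbhs_ballP[e /= e0 eP] := ng.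
have nf : \forall x \near (0 : 'rV[K]_n), forall x', U0 x' -> f x' = f x -> `|x'| < e.
  exact: (analytic_map_cvg0 fa (fU0 e e0)).
apply: filterS3 ng nf (singular_set_push np) => x [Whx hxK gx] fx sx [Ux xD].
split; first exact: Whx.
case: xD => [[x' [Ux' x'x fxx']]|/sx sgx]; [left | by right].
have [Whx' hx'K gx'] : transported W x'.
  apply: eP; rewrite -ball_normE /ball_ /= sub0r normrN.
  by apply: fx; [exact: UU0|].
exists (h x'); split=> //; last by rewrite gx gx' fxx'.
by move=> hE; apply: x'x; rewrite -hx'K hE.
Qed.

(** Nearness of the pair to 0 places both of its components where [h] conjugates
    [f] to [g]. *)
Lemma lifted_double_points_push (U W : set 'rV[K]_n) :
  (n <= p)%N -> open_nbhs (0 : 'rV[K]_n) W ->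
  \forall z \near (0 : 'rV[K]_n * 'rV[K]_n),
    lifted_double_points f U z -> lifted_double_points g W (h z.1, h z.2).
Proof.
move=> np W0; have ng := near_transported W0; have ns := singular_set_push np.
apply: filterS2 (near_pair ng ng) (near_pair ns ns).
move=> z [[Wx xK gx] [Wx' x'K gx']] [sx _] [_ _ zD].
split; [exact: Wx | exact: Wx' |].
case: zD => [[xx' fxx']|[xx' sfx]]; [left | right].
  split=> [hE|]; first by apply: xx'; rewrite -xK -x'K; congr (hi _).
  by rewrite gx gx' fxx'.
by split; [congr (h _) | exact: sx].
Qed.

(** A point near 0 of the image comes from some point of [U], which properness
    places near 0, where [h] conjugates [f] to [g]. *)
Lemma image_double_points_push (U0 U W : set 'rV[K]_n) :
  (n <= p)%N -> proper_on f U0 -> U `<=` U0 -> open_nbhs (0 : 'rV[K]_n) W ->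
  \forall y \near (0 : 'rV[K]_p),
    (f @` double_points f U) y -> (g @` double_points g W) (k y).
Proof.
move=> np fU0 UU0 W0.
have nD : \forall x \near (0 : 'rV[K]_n),
    (double_points f U x -> double_points g W (h x)) /\ g (h x) = k (f x).
  by apply: filterI ghE; exact: double_points_push fU0 UU0 W0.
have /nbhs_ballP[e /= e0 eP] := nD.
apply: filterS (fU0 e e0) => y yU0 [x xD fx].
have [|xDD gx] := eP x.
  rewrite -ball_normE /ball_ /= sub0r normrN; apply: yU0 => //.
  by apply: UU0; have [] := xD.
by exists (h x); [exact: xDD | rewrite gx fx].
Qed.

End Forward.
End Transfer.

(* The germs at 0 of the double point sets are those computed in any
   neighbourhoods U and W that are small enough. *)
Theorem proposition3p1 (R : realType) (c : ground) (n p : nat)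
  (f g : 'rV[ground_field R c]_n -> 'rV[ground_field R c]_p) :
  (2 <= n)%N -> (2 * n - 1 <= p)%N ->
  analytic_map_germ f -> finite_map_germ f ->
  analytic_map_germ g -> finite_map_germ g ->
  bilipschitz_A_equiv f g ->
  exists U0 : set 'rV[ground_field R c]_n,
    open_nbhs (0 : 'rV[ground_field R c]_n) U0 /\
    forall U W : set 'rV[ground_field R c]_n,
      open_nbhs (0 : 'rV[ground_field R c]_n) U -> U `<=` U0 ->
      open_nbhs (0 : 'rV[ground_field R c]_n) W -> W `<=` U0 ->
      [/\ bilipschitz_equiv_set_germs (double_points f U) (double_points g W),
          bilipschitz_equiv_set_germs (lifted_double_points f U)
                                      (lifted_double_points g W)
        & bilipschitz_equiv_set_germs (f @` double_points f U)
                                      (g @` double_points g W)].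
Proof.
move=> n2 np fa ff ga gf fg.
have Kca := ground_field_complete_archimedean R c.
have le_np : (n <= p)%N.
  by apply: leq_trans np; rewrite mul2n -addnn -addnBA ?leq_addr // ltnW.
have [h [hi [k [ki [hb kb ghE fhiE]]]]] := bilipschitz_A_equiv_conj Kca fa fg.
have [Uf Uf0 fU] := finite_germ_proper Kca ff.
have [Ug Ug0 gU] := finite_germ_proper Kca gf.
have : nbhs (0 : 'rV[ground_field R c]_n) (Uf `&` Ug) by exact: filterI.
rewrite nbhsE => -[U0 U0o U0s].
exists U0; split=> // U W Uo UU0 Wo WU0.
have UUf : U `<=` Uf by move=> x /UU0/U0s[].
have WUg : W `<=` Ug by move=> x /WU0/U0s[].
have hb' := bilipschitz_germ_sym hb; have kb' := bilipschitz_germ_sym kb.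
split.
- apply: (bilipschitz_equiv_set_germs_near hb).
    exact: (double_points_push Kca fa ga hb kb ghE le_np fU).
  exact: (double_points_push Kca ga fa hb' kb' fhiE le_np gU).
- apply: (bilipschitz_equiv_set_germs_near (bilipschitz_germ_square hb)).
    exact: (lifted_double_points_push Kca fa ga hb kb ghE).
  exact: (lifted_double_points_push Kca ga fa hb' kb' fhiE).
- apply: (bilipschitz_equiv_set_germs_near kb).
    exact: (image_double_points_push Kca fa ga hb kb ghE le_np fU).
  exact: (image_double_points_push Kca ga fa hb' kb' fhiE le_np gU).
Qed.
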